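(* Let $Z$ be a connected topological space and let $\mathcal{A}$ be a collection of closed subsets of $Z$ satisfying the following: (1) for every $A\in\mathcal{A}$, $A$ separates $Z$; (2) for all $A,B\in\mathcal{A}$, $A$ does not separate $B$; (3) for all distinct $A,B\in\mathcal{A}$, $A\cap B$ does not separate $Z$. Then there is a complete median pretree $\mathcal{P}$, whose elements are closed subsets of $Z$, satisfying the following: (I) $\mathcal{A}\subseteq\mathcal{P}$; (II) $Z=\bigcup\mathcal{P}$; (III) for all $A,C\in\mathcal{P}$, $C$ does not separate $A$; (IV) for all $A,B,C\in\mathcal{P}$ with $A\not\subseteq C$ and $B\not\subseteq C$: (a) if $C\in(A,B)$ then $C$ separates $A$ from $B$; (b) if $C$ separates $A$ from $B$, then $D\in(A,B)$ for some $D\in\mathcal{P}$ with $D\subseteq C$. Moreover, if $\mathcal{A}\cap L$ is countable for each linearly ordered subset $L$ of $\mathcal{P}$, then $\mathcal{P}$ is preseparable.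
   Context: Separation. A separation of a topological space $Y$ is a pair $(U,V)$ of disjoint nonempty open subsets of $Y$ with $Y=U\cup V$; $Y$ is connected iff it has no separation. Points $x,y\in Y$ are equivalent if there is no separation $(U,V)$ of $Y$ with $x\in U$, $y\in V$; the equivalence classes are the quasicomponents of $Y$. For $A,B,C\subseteq Z$: $A$ separates $B$ if there are $b,c\in B\setminus A$ lying in different quasicomponents of $Z\setminus A$; $A$ separates $B$ from $C$ if there are $b\in B\setminus A$ and $c\in C\setminus A$ lying in different quasicomponents of $Z\setminus A$. Pretrees. A pretree is a set $\mathcal{R}$ together with, for each pair $x,y\in\mathcal{R}$, a subset $(x,y)\subseteq\mathcal{R}$ (the elements between $x$ and $y$), such that for all $x,y,z\in\mathcal{R}$: $(x,x)=\emptyset$; $(x,y)=(y,x)$; if $x\in(y,z)$ then $y\notin(x,z)$; and $(x,z)\subseteq(x,y]\cup[y,z)$. Here $[x,y]=(x,y)\cup\{x,y\}$, $[x,y)=(x,y)\cup\{x\}$, $(x,y]=(x,y)\cup\{y\}$. A subset $X\subseteq\mathcal{R}$ is called linearly ordered if $X$ has a linear order (a natural linear order) such that the intervals of the linear order on $X$ are the same as the intervals in $\mathcal{R}$, i.e. for $x<y$ in $X$, $\{z\in X: x<z<y\}=(x,y)$. In any pretree each interval $[x,y]$ carries such a natural linear order, unique up to reversal. A pretree is complete if every interval, with a natural linear order, is complete: every nonempty subset with an upper bound has a supremum. The median of $x,y,z\in\mathcal{R}$ is the intersection $[x,y]\cap[y,z]\cap[x,z]$ (which has at most one element); $\mathcal{R}$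 is a median pretree if no median is empty. A pretree $\mathcal{R}$ is preseparable if for any linearly ordered subset $L$ of $\mathcal{R}$ there is a countable subset $Q\subseteq L$ such that $[a,b]\cap Q\neq\emptyset$ for all distinct $a,b\in L$. *)

(* Defs.v *)
From mathcomp Require Import all_boot all_order.
From mathcomp Require Import boolp classical_sets cardinality topology.

Set Implicit Arguments.
Unset Strict Implicit.
Unset Printing Implicit Defensive.

Local Open Scope classical_set_scope.

Section Separation.
Variable Z : topologicalType.
Implicit Types A B C Y U V : set Z.

Definition relatively_open Y U := exists2 O, open O & U = Y `&` O.

Definition separation Y U V :=
  [/\ relatively_open Y U, relatively_open Y V, U !=set0, V !=set0 &
      U `&` V = set0 /\ Y = U `|` V].

Definition quasi_equiv Y (x y : Z) :=
  ~ exists U V, [/\ separation Y U V, U x & V y].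

(* Only meaningful when Y x holds. *)
Definition quasicomponent Y (x : Z) : set Z :=
  [set y | Y y /\ quasi_equiv Y x y].

Definition separates_from A B C := exists b c,
  [/\ (B `\` A) b, (C `\` A) c &
      quasicomponent (~` A) b <> quasicomponent (~` A) c].

Definition separates A B := exists b c,
  [/\ (B `\` A) b, (B `\` A) c &
      quasicomponent (~` A) b <> quasicomponent (~` A) c].

End Separation.

(* The underlying set of a pretree is a set [carrier] of points of an ambient
   type [T]; the value of [between] outside [carrier] is irrelevant. *)
Record pretree (T : Type) := Pretree {
  carrier : set T ;
  between : T -> T -> set T ;
  between_carrier : forall x y, carrier x -> carrier y ->
    between x y `<=` carrier ;
  between_diag : forall x, carrier x -> between x x = set0 ;
  between_sym : forall x y, carrier x -> carrier y ->
    between x y = between y x ;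
  between_asym : forall x y z, carrier x -> carrier y -> carrier z ->
    between y z x -> ~ between x z y ;
  between_split : forall x y z, carrier x -> carrier y -> carrier z ->
    between x z `<=`
      (between x y `|` [set y]) `|` (between y z `|` [set y])
}.

Section Pretree.
Variables (T : Type) (R : pretree T).
Implicit Types (X L : set T) (lt : T -> T -> Prop).

Definition closed_interval (x y : T) : set T := between R x y `|` [set x; y].

Definition strict_linear_order X lt :=
  [/\ forall x, X x -> ~ lt x x,
      forall x y z, X x -> X y -> X z -> lt x y -> lt y z -> lt x z &
      forall x y, X x -> X y -> x <> y -> lt x y \/ lt y x].

(* Intervals are taken in the whole pretree, so such an X is convex. *)
Definition natural_linear_order X lt :=
  strict_linear_order X lt /\
  forall x y, X x -> X y -> lt x y ->
    [set z | [/\ X z, lt x z & lt z y]] = between R x y.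

Definition linearly_ordered X :=
  X `<=` carrier R /\ exists lt, natural_linear_order X lt.

Definition upper_bound X lt (S : set T) (u : T) :=
  X u /\ forall s, S s -> lt s u \/ s = u.

Definition supremum X lt (S : set T) (m : T) :=
  upper_bound X lt S m /\
  forall u, upper_bound X lt S u -> lt m u \/ m = u.

Definition complete_order X lt := forall S : set T,
  S `<=` X -> S !=set0 -> (exists u, upper_bound X lt S u) ->
  exists m, supremum X lt S m.

(* A natural linear order on an interval is unique up to reversal, and
   completeness is invariant under reversal, so which one is used is
   immaterial. *)
Definition complete_pretree := forall x y, carrier R x -> carrier R y ->
  exists2 lt, natural_linear_order (closed_interval x y) lt &
    complete_order (closed_interval x y) lt.

Definition median (x y z : T) : set T :=
  closed_interval x y `&` closed_interval y z `&` closed_interval x z.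

Definition median_pretree := forall x y z,
  carrier R x -> carrier R y -> carrier R z -> median x y z !=set0.

Definition preseparable := forall L, linearly_ordered L ->
  exists Q : set T, [/\ Q `<=` L, countable Q &
    forall a b, L a -> L b -> a <> b -> closed_interval a b `&` Q !=set0].

End Pretree.

(* Main.v *)
Require Import Defs.
From mathcomp Require Import all_boot all_order.
From mathcomp Require Import boolp classical_sets cardinality topology.

(** For a set X that no A in calA separates, the part of X off A lies in one
quasicomponent of the complement of A: call it the direction of X at A
([dir A X]), and let it be empty when X lies in A.  Distinct A, B in calA have
nonempty directions at each other, and hypothesis (3) makes the directions of
a point z outside both coherent ([coherent_point]): a clopen piece of the
complement of A missing B and one of the complement of B missing A would meet
in a clopen piece of the complement of the intersection of A and B, so they
are disjoint, and at least one of z's two directions faces the other member.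

The elements of the pretree ([vertex]) are the members of calA together with
the blocks: the maximal sets separated by no member of calA and contained in
none.  A vertex is determined by its directions ([vertex_inj]), so it is a
point of a product of stars, one star for each A, whose centre is the empty
direction and whose tips are the quasicomponents of the complement of A.
Betweenness is the one of the product.  Asymmetry and the behaviour of
intervals are then coordinatewise facts about stars; coherence is what makes
the median structure of the product tree-like ([within_split]).

Medians and suprema are built coordinatewise as a coherent choice m of
quasicomponents ([orientation]).  Its [core], the set of points that are, for
each A, in m A or in A, is the only candidate vertex.  The crux ([gap],
[core_vertex]) is that when m lies between two vertices X and Y and differs
from both, its core is a vertex: either a block with directions m, or a
member of calA at which m differs from X or from Y.  The reason is that the
complement of the core falls into two disjoint open sets, the points cut off
from m on the side of X and the others ([ahead], [elsewhere]); if the core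
were contained in some other way in a member A0 of calA, these would split
the complement of A0 between two members of calA that lie, seen from A0, in
one and the same direction.  For a median, the three choices of two vertices
out of three exclude the second alternative; for a supremum, the second
alternative yields the supremum itself.

The same two open sets show that a block separates the vertices that it lies
between ([betw_separates]).  Conversely a block C separates neither a vertex
nor two vertices that share a direction, at some A, other than that of C
([block_not_separates], [dir_eq_not_separates]).  Two distinct blocks always
have a member of calA between them, so calA is dense in the sense required
for preseparability. *)

Set Implicit Arguments.
Unset Strict Implicit.
Unset Printing Implicit Defensive.

Local Open Scope classical_set_scope.

(** * Betweenness in a star *)

Section Star.
Variables (V : Type) (o : V).
Implicit Types p q r s t : V.

(** The closed interval between p and q in the star with centre o whose other
points are all tips. *)
Definition star p q r := [\/ r = p, r = q | r = o /\ p <> q].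

Ltac star_cases :=
  rewrite /star;
  repeat match goal with
  | |- forall _, _ => intro
  | H : or3 _ _ _ |- _ => destruct H
  | H : _ /\ _ |- _ => destruct H
  end; subst; try congruence; auto using Or31, Or32, Or33.

Lemma star_l p q : star p q p. Proof. exact: Or31. Qed.
Lemma star_r p q : star p q q. Proof. exact: Or32. Qed.

Lemma star_sym p q r : star p q r -> star q p r.
Proof. by case=> [->|->|[-> pq]]; [exact: Or32|exact: Or31|apply: Or33; split=> // /esym]. Qed.

Lemma star_eq p r : star p p r -> r = p.
Proof. by case=> // -[]. Qed.

Lemma star_asym p q r : star q r p -> star p r q -> p = q.
Proof. star_cases. Qed.

Lemma star_not p q r : ~ star p q r -> r <> p /\ r <> q.
Proof. by move=> H; split=> e; apply: H; [exact: Or31|exact: Or32]. Qed.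

Lemma star_trans p q r s : star p r q -> star p s r -> star p s q.
Proof.
star_cases.
Qed.

(** Reading the interval from p as a linear order: if q comes before s, then every
point between q and s comes after q. *)
Lemma star_shift p q r s : star p s q -> star q s r -> star p r q.
Proof.
have [->|] := pselect (p = r); star_cases.
Qed.

Lemma star_mid p q r s : star p r q -> star p s r -> star q s r.
Proof.
have [->|] := pselect (q = s); star_cases.
Qed.

End Star.

(** * Clopen pieces of the complement of a closed set *)

Section Sides.
Variable Z : topologicalType.
Implicit Types (A B C U V X Y : set Z) (x y z : Z).

(** U and the complement of its union with A are the two parts of a possibly
trivial separation of the complement of A. *)
Definition side A U := [/\ open U, open (~` (A `|` U)) & U `<=` ~` A].

(** A one-sided form of lying in one quasicomponent of the complement of A; it is
symmetric off A because sides have opposites. *)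
Definition same A x y := forall U, side A U -> U x -> U y.

Lemma side_opp A U : side A U -> side A (~` (A `|` U)).
Proof.
case=> oU oV UA; split=> //; last by move=> z /not_orP[].
suff -> : ~` (A `|` ~` (A `|` U)) = U by [].
apply/seteqP; split=> z /=; last by move=> Uz [/(UA _ Uz)|]; [|apply; right].
by move=> /not_orP[Az /contrapT[]].
Qed.

Lemma same_refl A x : same A x x. Proof. by []. Qed.

Lemma same_trans A x y z : same A x y -> same A y z -> same A x z.
Proof. by move=> xy yz U sU /(xy _ sU)/(yz _ sU). Qed.

Lemma same_sym A x y : ~ A x -> ~ A y -> same A x y -> same A y x.
Proof.
move=> Ax Ay xy U sU Uy; apply: contrapT => Ux.
have /(_ _) := xy _ (side_opp sU).
by case=> [|]; [case|right].
Qed.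

Lemma not_same A x y : ~ same A x y -> exists U, [/\ side A U, U x & ~ U y].
Proof. by move=> /existsNP[U /not_implyP[sU /not_implyP[Ux Uy]]]; exists U. Qed.

(** The cross conditions make the closed set A + U (union) meet B + W exactly in the
union of the two intersections of A with B and of U with W, which is thus
closed. *)
Lemma sideI A B U W : side A U -> side B W ->
  U `<=` ~` B -> W `<=` ~` A -> side (A `&` B) (U `&` W).
Proof.
move=> [oU oU' UA] [oW oW' WB] UB WA; split; first exact: openI.
- suff -> : ~` (A `&` B `|` U `&` W) = ~` (A `|` U) `|` ~` (B `|` W).
    exact: openU.
  rewrite -setCI; congr (~` _); apply/seteqP; split=> z /=.
    by move=> [[]|[]] *; split; [left|left|right|right].
  move=> [[Az|Uz] [Bz|Wz]]; [by left; split|by case: (WA _ Wz)|by case: (UB _ Uz)|by right; split].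
- by move=> z [/UA Az _] [].
Qed.

(** Inside V, which avoids C, the set S and its opposite are both open; hence they
are both relatively closed, and cutting V along them stays clopen off A. *)
Lemma side_cut A C V S : side A V -> V `<=` ~` C -> side C S ->
  side A (V `&` S).
Proof.
move=> [oV oV' VA] VC [oS oS' SC]; split; first exact: openI.
- suff -> : ~` (A `|` V `&` S) = ~` (A `|` V) `|` (V `&` ~` (C `|` S)).
    by apply: openU => //; apply: openI.
  apply/seteqP; split=> z /=.
    move=> /not_orP[Az /not_andP VS].
    have [Vz|Vz] := pselect (V z); last by left; case.
    by right; split=> //; case=> [/(VC _ Vz)//|Sz]; case: VS.
  move=> [/not_orP[Az Vz]|[Vz /not_orP[Cz Sz]]]; first by case=> [//|[]].
  by case=> [/(VA _ Vz)//|[]].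
- by move=> z [/VA].
Qed.

Lemma quasi_equivP A x y : closed A -> ~ A x -> ~ A y ->
  quasi_equiv (~` A) x y <-> same A x y.
Proof.
move=> cA Ax Ay; split.
  move=> qe U [oU oV UA] Ux; apply: contrapT => Uy; apply: qe.
  exists U, (~` (A `|` U)); split=> //; last by case.
  split; [by exists U => //; apply/seteqP; split=> z // => [Uz|[]//]; split=> //; apply: UA
    | | by exists x|by exists y; case|split].
  - exists (~` (A `|` U)) => //; apply/seteqP; split=> z //; last by case.
    by move=> h; split=> //; move: h => /not_orP[].
  - by apply/seteqP; split=> z //= [Uz /not_orP[]].
  - apply/seteqP; split=> z /=; last by case=> [/UA//|/not_orP[]].
    by move=> Az; have [|Uz] := pselect (U z); [left|right; case].
move=> xy [U [V [[[O oO UE] [O' oO' VE] _ _ [UV UVE]] Ux Vy]]].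
have oA : open (~` A) by rewrite openC.
have : U y.
  apply: xy Ux; split; first by rewrite UE; apply: openI.
  - suff -> : ~` (A `|` U) = V by rewrite VE; apply: openI.
    apply/seteqP; split=> z /=.
      move=> /not_orP[Az Uz].
      by have : (~` A) z by []; rewrite UVE => -[].
    move=> Vz /= [Az|Uz]; first by move: Vz; rewrite VE => -[].
    by suff : (U `&` V) z by rewrite UV.
  - by rewrite UE => z [].
by move=> Uy; suff : (U `&` V) y by rewrite UV.
Qed.

Lemma quasicomponentP A x y : closed A -> ~ A x -> ~ A y ->
  quasicomponent (~` A) x = quasicomponent (~` A) y <-> same A x y.
Proof.
move=> cA Ax Ay; split.
  move=> e; apply/quasi_equivP => //.
  suff : quasicomponent (~` A) y y by rewrite -e => -[].
  by split=> //; apply/quasi_equivP.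
move=> xy; apply/seteqP; split=> z [/= Az /quasi_equivP h]; split=> //;
  apply/quasi_equivP => //.
- by apply: same_trans (h cA _ _) => //; apply: same_sym.
- exact: same_trans xy (h cA _ _).
Qed.

Lemma separates_fromP A B C : closed A -> separates_from A B C <->
  exists b c, [/\ (B `\` A) b, (C `\` A) c & ~ same A b c].
Proof.
move=> cA; split=> -[b [c [[Bb Ab] [Cc Ac] h]]];
  by exists b, c; split=> //; move: h; apply: contra_not => /quasicomponentP; exact.
Qed.

Lemma not_separatesP A B : closed A -> ~ separates A B <->
  forall x y, (B `\` A) x -> (B `\` A) y -> same A x y.
Proof.
move=> cA; split.
  move=> ns x y Bx By; apply: contrapT => xy; apply: ns.
  by apply/separates_fromP => //; exists x, y.
by move=> h /(separates_fromP _ _ cA)[b [c [Bb Cc]]]; apply; apply: h.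
Qed.

End Sides.

(** * Directions and their coherence *)

Section Tree.
Variables (Z : topologicalType) (calA : set (set Z)).
Hypothesis Aclosed : forall {A}, calA A -> closed A.
Hypothesis calA_separates : forall {A}, calA A -> separates A [set: Z].
Hypothesis calA_inseparable : forall {A B}, calA A -> calA B -> ~ separates A B.
Hypothesis calA_meet : forall {A B}, calA A -> calA B -> A <> B ->
  ~ separates (A `&` B) [set: Z].
Implicit Types (A B C U V X Y W : set Z) (x y z : Z) (m : set Z -> set Z).

Definition inseparable X := forall A x y, calA A ->
  X x -> X y -> ~ A x -> ~ A y -> same A x y.

Lemma inseparable_mem A : calA A -> inseparable A.
Proof.
move=> cA B x y cB Ax Ay Bx By.
by have /(not_separatesP _ (Aclosed cB)) := calA_inseparable cB cA; exact.
Qed.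

Lemma not_subset X Y : ~ X `<=` Y -> exists2 x, X x & ~ Y x.
Proof. by move=> /existsNP[x /not_implyP[]]; exists x. Qed.

Lemma mem_not_subset A B : calA A -> calA B -> A <> B -> ~ A `<=` B.
Proof.
move=> cA cB AB sAB; have := calA_meet cA cB AB.
by rewrite (setIidl sAB); apply; exact: calA_separates.
Qed.

Lemma same_setI A B x y : calA A -> calA B -> A <> B ->
  ~ (A `&` B) x -> ~ (A `&` B) y -> same (A `&` B) x y.
Proof.
move=> cA cB AB; have cAB : closed (A `&` B) by apply: closedI; exact: Aclosed.
have /(not_separatesP _ cAB) h := calA_meet cA cB AB.
by move=> ABx ABy; apply: h; split.
Qed.

(** Defined so that the points of X in A are ignored; the value is then empty
exactly when X is contained in A, which serves as the centre of the star at A. *)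
Definition dir A X := [set z | ~ A z /\ exists x, [/\ X x, ~ A x & same A x z]].

Lemma dir_sub A X : X `<=` A -> dir A X = set0.
Proof. by move=> XA; rewrite -subset0 => z [_ [x [/XA]]]. Qed.

Lemma dir_id A : dir A A = set0. Proof. exact: dir_sub. Qed.

Lemma mem_dir A X x : X x -> ~ A x -> dir A X x.
Proof. by move=> Xx Ax; split=> //; exists x; split=> //; exact: same_refl. Qed.

Lemma dir_neq0 A X x : X x -> ~ A x -> dir A X <> set0.
Proof. by move=> Xx Ax e; have := mem_dir Xx Ax; rewrite e. Qed.

Lemma dir_eq0 A X : dir A X = set0 -> X `<=` A.
Proof. by move=> e x Xx; apply: contrapT => /(dir_neq0 Xx). Qed.

Lemma dirE A X x : calA A -> inseparable X -> X x -> ~ A x ->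
  dir A X = dir A [set x].
Proof.
move=> cA iX Xx Ax; apply/seteqP; split=> z [Az].
  move=> [y [Xy Ay yz]]; split=> //; exists x; split=> //.
  exact: same_trans (iX _ _ _ cA Xx Xy Ax Ay) yz.
by move=> [_ [-> _ xz]]; split=> //; exists x.
Qed.

Lemma dir_pointP A x y : ~ A x -> ~ A y ->
  dir A [set x] = dir A [set y] <-> same A x y.
Proof.
move=> Ax Ay; split=> [e|xy].
  have : dir A [set x] y by rewrite e; apply: mem_dir.
  by case=> _ [_ [-> _]].
apply/seteqP; split=> z [Az [_ [-> _ h]]]; split=> //.
  by exists y; split=> //; apply: same_trans h; apply: same_sym.
by exists x; split=> //; apply: same_trans h.
Qed.

(** The tips of the star at A. *)
Definition quasi A (q : set Z) := exists2 x, ~ A x & q = dir A [set x].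

Lemma quasi_dir A X : calA A -> inseparable X -> ~ X `<=` A ->
  quasi A (dir A X).
Proof.
by move=> cA iX /not_subset[x Xx Ax]; exists x => //; exact: dirE.
Qed.

Lemma quasi_neq0 A q : quasi A q -> q <> set0.
Proof. by case=> x Ax -> ; apply: dir_neq0. Qed.

Lemma quasiE A q x : quasi A q -> q x -> q = dir A [set x].
Proof.
by case=> y Ay -> [Ax [_ [-> _ yx]]]; apply/dir_pointP.
Qed.

Lemma side_off_quasi A q x : quasi A q -> ~ A x -> ~ q x ->
  exists V, [/\ side A V, V x & V `<=` ~` q].
Proof.
move=> [y Ay ->] Ax qx.
have yx : ~ same A y x by move=> h; apply: qx; split=> //; exists y.
have [U [sU Uy Ux]] := not_same yx.
exists (~` (A `|` U)); split; [exact: side_opp|by case|].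
by move=> z /not_orP[Az Uz] [_ [_ [-> _ yz]]]; apply: Uz; apply: yz.
Qed.

(** A quasicomponent is an intersection of clopen pieces, so its complement off A
is a union of sides. *)
Lemma open_off A q : calA A -> quasi A q -> open (~` (q `|` A)).
Proof.
move=> cA qq.
suff -> : ~` (q `|` A) = \bigcup_(V in [set V | side A V /\ V `<=` ~` q]) V.
  by apply: bigcup_open => V [[]].
apply/seteqP; split=> z /=.
  move=> /not_orP[qz Az]; have [V [sV Vz Vq]] := side_off_quasi qq Az qz.
  by exists V.
by move=> [V [[_ _ VA] Vq] Vz] [/(Vq _ Vz)|/(VA _ Vz)].
Qed.

(** If both equalities fail, z lies in a side U of A that misses B and in a side V
of B that misses A.  Then the intersection of U and V is a side of that of A and
B ([sideI]); it contains z and no point of A, although the intersection of A and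
B does not separate Z. *)
Lemma coherent_point A B z : calA A -> calA B -> A <> B -> ~ A z -> ~ B z ->
  dir A [set z] = dir A B \/ dir B [set z] = dir B A.
Proof.
move=> cA cB AB Az Bz; apply: contrapT => /not_orP[hA hB].
have away A' B' : calA A' -> calA B' -> A' <> B' -> ~ A' z ->
    dir A' [set z] <> dir A' B' ->
    exists U, [/\ side A' U, U z & U `<=` ~` B'].
  move=> cA' cB' AB' Az' hA'.
  have iB := inseparable_mem cB'.
  have qB : quasi A' (dir A' B').
    by apply: quasi_dir => //; apply: mem_not_subset => // /esym.
  have [|U [sU Uz UB]] := side_off_quasi qB Az'.
    by move=> h; apply: hA'; rewrite (quasiE qB h).
  exists U; split=> // w Uw Bw.
  have Aw : ~ A' w by case: sU => _ _ /(_ _ Uw).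
  exact: (UB _ Uw (mem_dir Bw Aw)).
have [U [sU Uz UB]] := away A B cA cB AB Az hA.
have [V [sV Vz VA]] := away B A cB cA (nesym AB) Bz hB.
have [a Aa Ba] := not_subset (mem_not_subset cA cB AB).
have h : same (A `&` B) z a by apply: same_setI => // -[].
have [Ua _] := h _ (sideI sU sV UB VA) (conj Uz Vz).
by case: sU => _ _ /(_ _ Ua).
Qed.

(** * Vertices and orientations *)

Definition block X := [/\ inseparable X, forall A, calA A -> ~ X `<=` A &
  forall z, (forall A, calA A -> (dir A X `|` A) z) -> X z].

Definition vertex X := calA X \/ block X.

Lemma vertex_inseparable X : vertex X -> inseparable X.
Proof. by case=> [/inseparable_mem|[]]. Qed.

Lemma vertex_sub A X : calA A -> vertex X -> X `<=` A -> X = A.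
Proof.
move=> cA [cX XA|[_ nX _] /nX//]; apply: contrapT => ne.
exact: (mem_not_subset cX cA ne XA).
Qed.

Lemma vertex_quasi A X : calA A -> vertex X -> X <> A -> quasi A (dir A X).
Proof.
move=> cA vX XA; apply: quasi_dir => //; first exact: vertex_inseparable.
by move=> /(vertex_sub cA vX).
Qed.

Lemma vertex_dir0 A X : calA A -> vertex X -> dir A X = set0 -> X = A.
Proof. by move=> cA vX /dir_eq0; apply: vertex_sub. Qed.

(** If some point of X off A lies in B, then X and B share their direction at A;
otherwise X contains a point off both A and B, and inherits its coherence. *)
Lemma coherent X A B : vertex X -> calA A -> calA B -> A <> B ->
  dir A X = dir A B \/ dir B X = dir B A.
Proof.
move=> vX cA cB AB; have iX := vertex_inseparable vX.
have [->|XA] := pselect (X = A); first by right.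
have [->|XB] := pselect (X = B); first by left.
have [|x Xx Ax] := @not_subset X A; first by move/(vertex_sub cA vX).
have [|y Xy By] := @not_subset X B; first by move/(vertex_sub cB vX).
have [Bx|Bx] := pselect (B x).
  by left; rewrite (dirE cA iX Xx Ax) (dirE cA (inseparable_mem cB) Bx Ax).
by rewrite (dirE cA iX Xx Ax) (dirE cB iX Xx Bx); apply: coherent_point.
Qed.

(** A block contains every point that no member of calA cuts off from it, so it is
recovered from its directions. *)
Lemma vertex_inj X Y : vertex X -> vertex Y ->
  (forall A, calA A -> dir A X = dir A Y) -> X = Y.
Proof.
move=> vX vY e; case: (vX) => [cX|bX].
  by apply/esym/vertex_sub => //; apply: dir_eq0; rewrite -e // dir_id.
case: (vY) => [cY|bY].
  by apply: vertex_sub => //; apply: dir_eq0; rewrite e // dir_id.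
case: bX bY => [iX nX mX] [iY nY mY].
apply/seteqP; split=> z Xz; [apply: mY|apply: mX] => A cA;
  have [Az|Az] := pselect (A z); (try by right); left.
  by rewrite -e //; apply: mem_dir.
by rewrite e //; apply: mem_dir.
Qed.

Definition orientation m := (forall A, calA A -> quasi A (m A)) /\
  forall A B, calA A -> calA B -> A <> B -> m A = dir A B \/ m B = dir B A.

(** The points that no member of calA cuts off from the orientation m. *)
Definition core m := [set z | forall A, calA A -> (m A `|` A) z].

Lemma coreP m z : ~ core m z <->
  exists2 A, calA A & (~` (m A `|` A)) z.
Proof.
split; first by move=> /existsNP[A /not_implyP[cA h]]; exists A.
by move=> [A cA h] /(_ _ cA).
Qed.

Lemma core_closed m : orientation m -> closed (core m).
Proof.
move=> [qm _].
suff -> : core m = \bigcap_(A in calA) (m A `|` A).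
  apply: closed_bigI => A cA; rewrite -openC; apply: open_off => //; exact: qm.
by apply/seteqP; split.
Qed.

Lemma core_dir m A x : orientation m -> calA A -> core m x -> ~ A x ->
  m A = dir A [set x].
Proof. by move=> [qm _] cA /(_ _ cA)[mx _|//]; apply: quasiE => //; exact: qm. Qed.

Lemma core_inseparable m : orientation m -> inseparable (core m).
Proof.
move=> om A x y cA mx my Ax Ay; apply/dir_pointP => //.
by rewrite -(core_dir om cA mx Ax) -(core_dir om cA my Ay).
Qed.

Lemma dir_core m A : orientation m -> calA A -> ~ core m `<=` A ->
  dir A (core m) = m A.
Proof.
move=> om cA /not_subset[x mx Ax].
by rewrite (core_dir om cA mx Ax); apply: dirE => //; exact: core_inseparable.
Qed.

Lemma core_block m : orientation m -> (forall A, calA A -> ~ core m `<=` A) ->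
  block (core m).
Proof.
move=> om h; split=> //; first exact: core_inseparable.
by move=> z hz A cA; rewrite -(dir_core om cA (h _ cA)); apply: hz.
Qed.

Lemma block_orientation X : block X -> orientation (dir^~ X).
Proof.
move=> bX; have [iX nX _] := bX; split=> [A cA|A B cA cB AB].
  by apply: quasi_dir => //; exact: nX.
by apply: coherent => //; right.
Qed.

Lemma core_of_block X : block X -> core (dir^~ X) = X.
Proof.
move=> [_ _ mX]; apply/seteqP; split=> // z Xz A cA.
by have [Az|Az] := pselect (A z); [right|left; apply: mem_dir].
Qed.

Lemma vertex_closed X : vertex X -> closed X.
Proof.
case=> [/Aclosed//|bX]; rewrite -(core_of_block bX).
by apply: core_closed; exact: block_orientation.
Qed.

(** A point outside all members of calA has a direction at each of them, and the
core of this orientation contains it. *)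
Lemma vertex_cover z : exists2 X, vertex X & X z.
Proof.
have [[A cA Az]|nA] := pselect (exists2 A, calA A & A z).
  by exists A => //; left.
have zA A : calA A -> ~ A z by move=> cA Az; apply: nA; exists A.
pose m A := dir A [set z].
have om : orientation m.
  split=> [A cA|A B cA cB AB]; first by exists z => //; exact: zA.
  by apply: coherent_point => //; exact: zA.
have mz : core m z by move=> A cA; left; apply: mem_dir => //; exact: zA.
exists (core m) => //; right; apply: core_block => // A cA.
by move=> /(_ _ mz); exact: zA.
Qed.

(** * Blocks do not separate vertices *)

(** A side V of A that contains x and avoids C can be cut along S, since S and its
opposite are open there ([side_cut]). *)
Lemma side_constant_off A C S x y : quasi A (dir A C) -> C `<=` dir A C `|` A ->
  side C S -> same A x y -> (~` (dir A C `|` A)) x -> S x -> S y.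
Proof.
move=> qC sC sS xy /not_orP[Cx Ax] Sx.
have [V [sV Vx VC]] := side_off_quasi qC Ax Cx.
have VC' : V `<=` ~` C.
  by move=> z Vz /sC[/(VC _ Vz)//|]; case: sV => _ _ /(_ _ Vz).
by have [] := xy _ (side_cut sV VC' sS) (conj Vx Sx).
Qed.

Lemma off_block C x : block C -> ~ C x ->
  exists2 A, calA A & (~` (dir A C `|` A)) x.
Proof. by move=> bC Cx; apply/coreP; rewrite core_of_block. Qed.

Lemma sub_block_dir A C : calA A -> block C -> C `<=` dir A C `|` A.
Proof. by move=> cA bC z; rewrite -{1}(core_of_block bC) => /(_ _ cA). Qed.

Lemma block_dir_quasi A C : calA A -> block C -> quasi A (dir A C).
Proof. by move=> cA bC; have [+ _] := block_orientation bC; apply. Qed.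

Lemma dir_neq_of_off A X m x : calA A -> inseparable X -> orientation m ->
  X x -> (~` (m A `|` A)) x -> dir A X <> m A.
Proof. by move=> cA iX om Xx /not_orP[mx Ax] e; apply: mx; rewrite -e; apply: mem_dir. Qed.

(** Suppose that S splits X.  The part of X off any A that cuts x off from C lies on
one side of S, so y must lie in A; symmetrically x lies in any B that cuts y
off from C.  Then C has neither the direction of B at A nor that of A at B,
against coherence. *)
Lemma block_not_separates C X x y : block C -> vertex X ->
  X x -> X y -> ~ C x -> ~ C y -> same C x y.
Proof.
move=> bC vX Xx Xy Cx Cy S sS Sx; apply: contrapT => Sy.
have iX := vertex_inseparable vX.
have [A cA Ax] := off_block bC Cx; have [B cB By] := off_block bC Cy.
have [Ax' By'] : ~ A x /\ ~ B y by split=> h; [apply: Ax|apply: By]; right.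
have Ay : A y.
  apply: contrapT => Ay; apply: Sy.
  apply: (side_constant_off (block_dir_quasi cA bC) (sub_block_dir cA bC) sS _ Ax Sx).
  exact: (iX A).
have Bx : B x.
  apply: contrapT => Bx.
  have Ty : (~` (C `|` S)) y by case.
  have yx : same B y x by exact: (iX B).
  have := side_constant_off (block_dir_quasi cB bC) (sub_block_dir cB bC) (side_opp sS) yx By Ty.
  by case; right.
(* The two witnesses cross: y lies in A and x lies in B. *)
have AB : A <> B by move=> e; case: By; right; rewrite -e.
have iA := inseparable_mem cA; have iB := inseparable_mem cB.
have oC := block_orientation bC.
case: (oC.2 _ _ cA cB AB) => e.
  by apply: (dir_neq_of_off cA iB oC Bx Ax).
by apply: (dir_neq_of_off cB iA oC Ay By).
Qed.

(** * The gap between two vertices *)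

(** The points cut off from m by a member of calA that also cuts X off from m, or
that is X. *)
Definition ahead X m := [set z | exists2 A, calA A &
  dir A X <> m A /\ (~` (m A `|` A)) z].

Definition facing m A B := m A = dir A B /\ m B = dir B A.

(** The points cut off from m in some other way.  Members of calA that are cut off
from m by a member ahead would be counted on the wrong side; facing each other
across m excludes them. *)
Definition elsewhere X m := [set z | exists2 B, calA B &
  (forall A, calA A -> dir A X <> m A -> facing m A B) /\ (~` (m B `|` B)) z].

Section Orientation.
Variable m : set Z -> set Z.
Hypothesis om : orientation m.

Lemma open_ahead X : open (ahead X m).
Proof.
suff -> : ahead X m =
    \bigcup_(A in [set A | calA A /\ dir A X <> m A]) ~` (m A `|` A).
  by apply: bigcup_open => A [cA _]; apply: open_off => //; exact: om.1.
by apply/seteqP; split=> z [A]; [move=> cA [? ?]; exists A|case=> cA ? ?; exists A].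
Qed.

Lemma open_elsewhere X : open (elsewhere X m).
Proof.
suff -> : elsewhere X m = \bigcup_(B in [set B | calA B /\
    forall A, calA A -> dir A X <> m A -> facing m A B]) ~` (m B `|` B).
  by apply: bigcup_open => A [cA _]; apply: open_off => //; exact: om.1.
by apply/seteqP; split=> z [A]; [move=> cA [? ?]; exists A|case=> cA ? ?; exists A].
Qed.

Lemma orientation_neq0 A : calA A -> m A <> set0.
Proof. by move=> cA; apply: (@quasi_neq0 A); exact: om.1. Qed.

(** Facing members cut off disjoint sets, by the coherence of points. *)
Lemma ahead_elsewhere X z : ahead X m z -> elsewhere X m z -> False.
Proof.
move=> [A cA [XA /not_orP[mAz Az]]] [B cB [/(_ _ cA XA)[fA fB] /not_orP[mBz Bz]]].
have AB : A <> B.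
  by move=> e; move: fA; rewrite e dir_id; exact: orientation_neq0.
case: (coherent_point cA cB AB Az Bz) => e.
  by apply: mAz; rewrite fA -e; apply: mem_dir.
by apply: mBz; rewrite fB -e; apply: mem_dir.
Qed.

Lemma dir_toward X A B : vertex X -> calA A -> calA B ->
  dir A X <> m A -> dir B X = m B -> m B = dir B A.
Proof.
move=> vX cA cB XA XB; have AB : A <> B by move=> e; apply: XA; rewrite e.
case: (coherent vX cA cB AB) => [e|<- //].
by case: (om.2 _ _ cA cB AB) => // e'; case: XA; rewrite e e'.
Qed.

(** If B does not cut X off from m and fails to face some A that does, then B lies
behind A as seen from m, and A cuts off whatever B cuts off. *)
Lemma ahead_or_elsewhere X z : vertex X -> ~ core m z ->
  ahead X m z \/ elsewhere X m z.
Proof.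
move=> vX /coreP[B cB Bz].
have [XB|XB] := pselect (dir B X = m B); last by left; exists B.
have [f|] := pselect (forall A, calA A -> dir A X <> m A -> facing m A B).
  by right; exists B.
move=> /existsNP[A /not_implyP[cA /not_implyP[XA nf]]]; left; exists A => //.
split=> //; have tB := dir_toward vX cA cB XA XB.
have AB : A <> B by move=> e; apply: XA; rewrite e.
have mA : m A <> dir A B by move=> h; apply: nf.
case/not_orP: Bz => mBz Bz.
have Az : ~ A z by move=> Az; apply: mBz; rewrite tB; apply: mem_dir.
case=> // mAz; case: (coherent_point cA cB AB Az Bz) => e.
  by apply: mA; rewrite -e; apply: quasiE => //; exact: om.1.
by apply: mBz; rewrite tB -e; apply: mem_dir.
Qed.

Section Between.
Variables X Y : set Z.
Hypotheses (vX : vertex X) (vY : vertex Y).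
Hypothesis mXY : forall A, calA A -> m A = dir A X \/ m A = dir A Y.

Lemma between_facing A B : calA A -> calA B ->
  dir A X <> m A -> dir B Y <> m B -> facing m A B.
Proof.
move=> cA cB XA YB.
have XB : dir B X = m B by case: (mXY cB) => // /esym.
have YA : dir A Y = m A by case: (mXY cA) => // /esym.
by split; [exact: dir_toward vY cB cA YB YA|exact: dir_toward vX cA cB XA XB].
Qed.

Lemma ahead_sub_elsewhere : ahead Y m `<=` elsewhere X m.
Proof.
move=> z [B cB [YB Bz]]; exists B => //; split=> // A cA XA.
exact: between_facing.
Qed.

End Between.

(** A member of calA that cuts X off can only be cut off from m on the side of X. *)
Lemma ahead_witness X A a : vertex X -> calA A -> dir A X <> m A -> A a ->
  ~ core m a -> exists B, [/\ calA B, dir B X <> m B, dir B A <> m B &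
     (~` (m B `|` B)) a].
Proof.
move=> vX cA XA Aa /coreP[B cB Ba].
have BA : dir B A <> m B by apply: dir_neq_of_off Ba => //; exact: inseparable_mem.
have AB : A <> B by move=> e; case: Ba; right; rewrite -e.
exists B; split=> // XB.
have e : m A = dir A B by case: (om.2 _ _ cA cB AB) => // /esym.
by case: (coherent vX cA cB AB) => [|]; rewrite ?XB -?e //; move/esym.
Qed.

Lemma mem_ahead X A a : vertex X -> calA A -> dir A X <> m A -> A a ->
  ~ core m a -> ahead X m a.
Proof.
by move=> vX cA XA Aa na; have [B [cB XB _ Ba]] := ahead_witness vX cA XA Aa na; exists B.
Qed.

(** When the core is contained in A0, the complement of A0 is partitioned into the
two open sets ahead of X and elsewhere, and these contain points of A and of B
respectively. *)
Lemma gap_split X Y A0 A B : vertex X -> vertex Y ->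
  (forall A, calA A -> m A = dir A X \/ m A = dir A Y) ->
  calA A0 -> core m `<=` A0 -> calA A -> calA B -> A <> A0 -> B <> A0 ->
  dir A X <> m A -> dir B Y <> m B -> dir A0 A <> dir A0 B.
Proof.
move=> vX vY mXY c0 m0 cA cB A0A A0B XA YB e.
have [a Aa na] := not_subset (mem_not_subset cA c0 A0A).
have [b Bb nb] := not_subset (mem_not_subset cB c0 A0B).
have ma : ~ core m a by move/m0.
have mb : ~ core m b by move/m0.
have o0 : open (~` A0) by rewrite openC; exact: Aclosed.
have sU : side A0 (~` A0 `&` ahead X m).
  split; [by apply: openI => //; exact: open_ahead| |by move=> z []].
  suff -> : ~` (A0 `|` ~` A0 `&` ahead X m) = ~` A0 `&` elsewhere X m.
    by apply: openI => //; exact: open_elsewhere.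
  apply/seteqP; split=> z /=.
    move=> /not_orP[n0 h]; split=> //.
    have [|hz|//] := @ahead_or_elsewhere X z vX; first by move/m0.
    by case: h.
  by move=> [n0 ez] [//|[_ /ahead_elsewhere]]; apply.
have ab : same A0 a b.
  apply/dir_pointP => //.
  by rewrite -(dirE c0 (inseparable_mem cA) Aa na)
             -(dirE c0 (inseparable_mem cB) Bb nb).
have [_ hb] := ab _ sU (conj na (mem_ahead vX cA XA Aa ma)).
apply: (ahead_elsewhere hb); apply: (ahead_sub_elsewhere vX vY mXY).
exact: mem_ahead vY cB YB Bb mb.
Qed.

(** Otherwise some B on the side of Y would cut A0 off from m, and then A and B
would lie in the same direction m A0 from A0. *)
Lemma gap_half X Y A0 A : vertex X -> vertex Y ->
  (forall A, calA A -> m A = dir A X \/ m A = dir A Y) ->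
  calA A0 -> core m `<=` A0 -> calA A -> dir A X <> m A ->
  dir A0 Y <> m A0 -> core m = A0.
Proof.
move=> vX vY mXY c0 m0 cA XA Y0; apply/seteqP; split=> // a A0a.
apply: contrapT => na.
have [B [cB YB hB Ba]] := ahead_witness vY c0 Y0 A0a na.
have X0 : dir A0 X = m A0 by case: (mXY _ c0) => // /esym.
have A0A : A <> A0 by move=> e; apply: XA; rewrite e.
have A0B : B <> A0 by move=> e; case: Ba; right; rewrite e.
apply: (gap_split vX vY mXY c0 m0 cA cB A0A A0B XA YB).
rewrite -(dir_toward vX cA c0 XA X0).
by case: (om.2 _ _ cB c0 A0B) => // e; case: hB.
Qed.

(** If m A0 agrees with both X and Y, then A and B are both in the direction m A0
from A0, against [gap_split].  The core can thus only be contained in an A0 at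
which m leaves X or Y, and it then fills A0. *)
Lemma gap X Y A0 A B : vertex X -> vertex Y ->
  (forall A, calA A -> m A = dir A X \/ m A = dir A Y) ->
  calA A0 -> core m `<=` A0 ->
  calA A -> dir A X <> m A -> calA B -> dir B Y <> m B ->
  core m = A0 /\ (dir A0 X <> m A0 \/ dir A0 Y <> m A0).
Proof.
move=> vX vY mXY c0 m0 cA XA cB YB.
have mYX A' : calA A' -> m A' = dir A' Y \/ m A' = dir A' X.
  by move=> /mXY[]; [right|left].
have [X0|X0] := pselect (dir A0 X = m A0); last first.
  by split; [exact: gap_half vY vX mYX c0 m0 cB YB X0|left].
have [Y0|Y0] := pselect (dir A0 Y = m A0); last first.
  by split; [exact: gap_half vX vY mXY c0 m0 cA XA Y0|right].
have A0A : A <> A0 by move=> e; apply: XA; rewrite e.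
have A0B : B <> A0 by move=> e; apply: YB; rewrite e.
exfalso; apply: (gap_split vX vY mXY c0 m0 cA cB A0A A0B XA YB).
by rewrite -(dir_toward vX cA c0 XA X0) -(dir_toward vY cB c0 YB Y0).
Qed.

End Orientation.

(** * The pretree of vertices *)

(** The closed interval of the product of stars. *)
Definition within X Y := [set C | forall A, calA A ->
  star set0 (dir A X) (dir A Y) (dir A C)].

Lemma within_l X Y : within X Y X. Proof. by move=> A _; exact: star_l. Qed.
Lemma within_r X Y : within X Y Y. Proof. by move=> A _; exact: star_r. Qed.

Lemma within_sym X Y C : within X Y C -> within Y X C.
Proof. by move=> h A cA; apply: star_sym; exact: h. Qed.

(** Suppose that C leaves the interval from X to W at A, and the one from W to Y at
B, and that W has the direction of B at A.  As C differs from W at A, it has the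
direction of A at B; Y differs from C there, so Y agrees with W at A, and C lies
between X and W at A after all. *)
Lemma within_split X Y W C : vertex X -> vertex Y -> vertex W -> vertex C ->
  within X Y C -> within X W C \/ within W Y C.
Proof.
move=> vX vY vW vC h; apply: contrapT => /not_orP[].
move=> /existsNP[A /not_implyP[cA hA]] /existsNP[B /not_implyP[cB hB]].
have hWX : ~ star set0 (dir A W) (dir A X) (dir A C).
  by move=> h'; apply: hA; exact: star_sym.
have hYW : ~ star set0 (dir B Y) (dir B W) (dir B C).
  by move=> h'; apply: hB; exact: star_sym.
have AB : A <> B.
  move=> e; move: hB; rewrite -e => hB; have := h _ cA.
  have [AC AW] := star_not hA; have [AW' AY] := star_not hB.
  case=> // -[e0 XY]; have [WX|WX] := pselect (dir A X = dir A W).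
    by apply: hB; apply: Or33; split=> // WY; apply: XY; rewrite WX.
  by apply: hA; apply: Or33.
(* By coherence W has the direction of B at A, or that of A at B; the second
   case exchanges A with B and X with Y. *)
have key A' B' X' Y' : calA A' -> calA B' -> A' <> B' -> vertex X' ->
    vertex Y' -> within X' Y' C ->
    ~ star set0 (dir A' X') (dir A' W) (dir A' C) ->
    ~ star set0 (dir B' W) (dir B' Y') (dir B' C) ->
    dir A' W = dir A' B' -> False.
  move=> cA' cB' AB' vX' vY' h' hA' hB' WA.
  have [AX AW] := star_not hA'; have [BW BY] := star_not hB'.
  have CB : dir B' C = dir B' A'.
    by case: (coherent vC cA' cB' AB') => // e; case: AW; rewrite e.
  have YA : dir A' Y' = dir A' B'.
    by case: (coherent vY' cA' cB' AB') => // e; case: BY; rewrite CB e.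
  by move: (h' _ cA'); rewrite YA -WA.
case: (coherent vW cA cB AB) => e.
  exact: (key A B X Y).
by apply: (key B A Y X) => //; [exact: nesym|exact: within_sym].
Qed.

Definition betw X Y := [set C | [/\ vertex C, C <> X, C <> Y & within X Y C]].

Lemma within_eq X C : vertex X -> vertex C -> within X X C -> C = X.
Proof.
by move=> vX vC h; apply: vertex_inj => // A cA; apply: star_eq (h _ cA).
Qed.

Lemma within_asym X Y W : vertex X -> vertex Y ->
  within Y W X -> within X W Y -> X = Y.
Proof.
move=> vX vY h h'; apply: vertex_inj => // A cA.
exact: star_asym (h _ cA) (h' _ cA).
Qed.

Lemma betw_carrier X Y : vertex X -> vertex Y -> betw X Y `<=` vertex.
Proof. by move=> _ _ C []. Qed.

Lemma betw_diag X : vertex X -> betw X X = set0.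
Proof. by move=> vX; rewrite -subset0 => C [vC CX _ h]; apply/CX/within_eq. Qed.

Lemma betw_sym X Y : vertex X -> vertex Y -> betw X Y = betw Y X.
Proof.
by move=> _ _; apply/seteqP; split=> C [vC CX CY h]; split=> //; exact: within_sym.
Qed.

Lemma betw_asym X Y W : vertex X -> vertex Y -> vertex W ->
  betw Y W X -> ~ betw X W Y.
Proof. by move=> vX vY vW [_ XY _ h] [_ _ _ h']; apply: XY; apply: within_asym h h'. Qed.

Lemma betw_split X Y W : vertex X -> vertex Y -> vertex W ->
  betw X W `<=` (betw X Y `|` [set Y]) `|` (betw Y W `|` [set Y]).
Proof.
move=> vX vY vW C [vC CX CW h].
have [->|CY] := pselect (C = Y); first by left; right.
by case: (within_split vX vW vY vC h) => h'; [left; left|right; left].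
Qed.

Definition tree : pretree (set Z) :=
  Pretree betw_carrier betw_diag betw_sym betw_asym betw_split.

Lemma closed_intervalP X Y C : vertex X -> vertex Y ->
  closed_interval tree X Y C <-> vertex C /\ within X Y C.
Proof.
move=> vX vY; split.
  case=> [[]//|[->|->]]; split=> //; [exact: within_l|exact: within_r].
move=> [vC h]; have [->|CX] := pselect (C = X); first by right; left.
have [->|CY] := pselect (C = Y); first by right; right.
by left.
Qed.

(** * Medians *)

(** By coherence, at any other B one of X and Y has the direction of A. *)
Lemma fork_within X Y A : vertex X -> vertex Y -> calA A ->
  dir A X <> dir A Y -> within X Y A.
Proof.
move=> vX vY cA XY B cB; have [->|AB] := pselect (B = A).
  by rewrite dir_id; apply: Or33.
case: (coherent vX cA cB (nesym AB)) => e; last by rewrite e; exact: star_l.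
case: (coherent vY cA cB (nesym AB)) => e'; last by rewrite e'; exact: star_r.
by case: XY; rewrite e.
Qed.

(** The use of [gap]: [core m] is a vertex, and in the second case it lies at an
end of one of the two families of members of calA cut off on the sides of X
and of Y. *)
Lemma core_vertex m X Y : orientation m -> vertex X -> vertex Y ->
  (forall A, calA A -> m A = dir A X \/ m A = dir A Y) ->
  (exists2 A, calA A & dir A X <> m A) -> (exists2 A, calA A & dir A Y <> m A) ->
  (block (core m) /\ forall A, calA A -> dir A (core m) = m A) \/
  (calA (core m) /\ (dir (core m) X <> m (core m) \/ dir (core m) Y <> m (core m))).
Proof.
move=> om vX vY mXY [A cA XA] [B cB YB].
have [h|] := pselect (forall A, calA A -> ~ core m `<=` A).
  by left; split; [exact: core_block|move=> A0 c0; apply: dir_core => //; exact: h].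
move=> /existsNP[A0 /not_implyP[c0 /contrapT m0]]; right.
by have [-> h] := gap om vX vY mXY c0 m0 cA XA cB YB.
Qed.

Lemma tree_median : median_pretree tree.
Proof.
move=> X Y W vX vY vW.
suff [C [vC h1 h2 h3]] : exists C, [/\ vertex C, within X Y C, within Y W C & within X W C].
  by exists C; split; [split|]; apply/closed_intervalP.
have [XY|XY] := pselect (X = Y).
  by exists X; split=> //; rewrite ?XY; by [exact: within_l|exact: within_r].
have [YW|YW] := pselect (Y = W).
  by exists Y; split=> //; rewrite -?YW; by [exact: within_l|exact: within_r].
have [XW|XW] := pselect (X = W).
  by exists X; split=> //; rewrite -?XW; by [exact: within_l|exact: within_r].
(* A member at which the three directions are distinct is itself the median. *)
have [[A [cA nXY nYW nXW]]|nA] := pselect (exists A, [/\ calA A,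
    dir A X <> dir A Y, dir A Y <> dir A W & dir A X <> dir A W]).
  by exists A; split; [left|exact: fork_within..].
(* The majority vote; the remaining case is one where Y or X agrees with W. *)
pose m A := if pselect (dir A X = dir A Y) then dir A X else dir A W.
have mP A : calA A -> [\/ dir A X = m A /\ dir A Y = m A,
    dir A Y = m A /\ dir A W = m A | dir A X = m A /\ dir A W = m A].
  move=> cA; rewrite /m; case: pselect => [e|ne]; first by apply: Or31.
  have [e|ne'] := pselect (dir A Y = dir A W); first by apply: Or32.
  have [e|ne''] := pselect (dir A X = dir A W); first by apply: Or33.
  by case: nA; exists A.
have mXY A : calA A -> m A = dir A X \/ m A = dir A Y.
  by move=> /mP[] [e e']; [left|right|left].
have mYW A : calA A -> m A = dir A Y \/ m A = dir A W.
  by move=> /mP[] [e e']; [left|left|right].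
have mXW A : calA A -> m A = dir A X \/ m A = dir A W.
  by move=> /mP[] [e e']; [left|right|left].
have within_m U V C : (forall A, calA A -> m A = dir A U \/ m A = dir A V) ->
    (forall A, calA A -> dir A C = m A) -> within U V C.
  by move=> mUV mC A cA; rewrite mC //; case: (mUV _ cA) => ->; [exact: star_l|exact: star_r].
have mvertex C : vertex C -> (forall A, calA A -> dir A C = m A) ->
    exists C, [/\ vertex C, within X Y C, within Y W C & within X W C].
  by move=> vC mC; exists C; split=> //; apply: within_m.
have somewhere C : vertex C ->
    (exists C, [/\ vertex C, within X Y C, within Y W C & within X W C]) \/
    exists2 A, calA A & dir A C <> m A.
  move=> vC; have [h|] := pselect (forall A, calA A -> dir A C = m A).
    by left; exact: mvertex h.
  by move=> /existsNP[A /not_implyP[cA h]]; right; exists A.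
case: (somewhere X vX) => // dX; case: (somewhere Y vY) => // dY.
case: (somewhere W vW) => // dW.
have om : orientation m.
  split=> [A cA|A B cA cB AB].
    have [V vV [VA mA]] : exists2 V, vertex V & V <> A /\ m A = dir A V.
      have [XA|XA] := pselect (X = A); last first.
        have [YA|YA] := pselect (Y = A); last first.
          by case: (mXY _ cA); [exists X|exists Y].
        by case: (mXW _ cA); [exists X|exists W => //; split=> // e; apply: YW; rewrite e].
      by case: (mYW _ cA); [exists Y => //; split=> // e; apply: XY; rewrite e
                           |exists W => //; split=> // e; apply: XW; rewrite e].
    by rewrite mA; exact: vertex_quasi.
  apply: contrapT => /not_orP[mA mB].
  have step V : vertex V -> dir A V = m A -> dir B V = dir B A.
    by move=> vV VA; case: (coherent vV cA cB AB) => // e; case: mA; rewrite -VA.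
  apply: mB; case: (mP _ cA) => -[/step e1 /step e2];
    case: (mP _ cB) => -[e3 e4];
    by [rewrite -e3 e1|rewrite -e4 e2|rewrite -e3 e2|rewrite -e4 e1].
(* The three families of members at which X, Y or W is outvoted are pairwise
   disjoint, while a core in calA would belong to one of any two of them. *)
case: (core_vertex om vX vY mXY dX dY) => [[bC mC]|[c0 h1]].
  by apply: mvertex mC; right.
case: (core_vertex om vY vW mYW dY dW) => [[bC mC]|[_ h2]].
  by apply: mvertex mC; right.
case: (core_vertex om vX vW mXW dX dW) => [[bC mC]|[_ h3]].
  by apply: mvertex mC; right.
by exfalso; case: (mP _ c0) => -[e1 e2]; case: h1 => //; case: h2 => //; case: h3.
Qed.

(** * Intervals and completeness *)

(** The order of an interval starting at X. *)
Definition precedes X C D := C <> D /\ within X D C.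

Lemma within_trans X C D E : within X D C -> within X C E -> within X D E.
Proof. by move=> h h' A cA; exact: star_trans (h' _ cA) (h _ cA). Qed.

Lemma within_shift X D C E : within X D C -> within C D E -> within X E C.
Proof. by move=> h h' A cA; exact: star_shift (h _ cA) (h' _ cA). Qed.

Lemma within_mid X D C E : within X D C -> within X C E -> within E D C.
Proof. by move=> h h' A cA; exact: star_mid (h' _ cA) (h _ cA). Qed.

Lemma within_antisym X C D : vertex C -> vertex D ->
  within X D C -> within X C D -> C = D.
Proof. by move=> vC vD h h'; apply: within_asym (within_sym h) (within_sym h'). Qed.

Lemma within_total X Y C D : vertex X -> vertex Y -> vertex C -> vertex D ->
  within X Y C -> within X Y D -> within X D C \/ within X C D.
Proof.
move=> vX vY vC vD hC hD; case: (within_split vX vY vC vD hD) => h; first by right.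
by left; apply: within_shift hC h.
Qed.

Lemma tree_order X Y : vertex X -> vertex Y ->
  natural_linear_order tree (closed_interval tree X Y) (precedes X).
Proof.
move=> vX vY; split.
  split=> [C _ []//|C D E|C D].
    move=> /(closed_intervalP _ vX vY)[vC _] /(closed_intervalP _ vX vY)[vD _] _.
    move=> [CD h] [DE h']; split; last exact: within_trans h' h.
    by move=> e; apply: CD; apply: (within_antisym vC vD h); rewrite e.
  move=> /(closed_intervalP _ vX vY)[vC hC] /(closed_intervalP _ vX vY)[vD hD] CD.
  case: (within_total vX vY vC vD hC hD) => h; [left|right]; split=> //.
  exact: nesym.
move=> C D /(closed_intervalP _ vX vY)[vC hC] /(closed_intervalP _ vX vY)[vD hD] [CD h].
apply/seteqP; split=> E.
  move=> [/(closed_intervalP _ vX vY)[vE hE] [CE h1] [ED h2]]; split=> //.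
    exact: nesym.
  exact: within_mid h2 h1.
move=> [vE EC ED hE].
have h2 : within X D E.
  by apply: within_sym; apply: within_trans (within_sym h) (within_sym hE).
split; first by apply/closed_intervalP => //; split=> //; apply: within_trans hD h2.
- by split; [exact: nesym|exact: within_shift h hE].
- by split.
Qed.

Lemma tree_complete : complete_pretree tree.
Proof.
move=> X Y vX vY; exists (precedes X); first exact: tree_order.
move=> S SXY [s0 Ss0] _.
have {}SXY s : S s -> vertex s /\ within X Y s.
  by move=> /SXY /(closed_intervalP _ vX vY).
have refl C : within X C C by exact: within_r.
have leP C D : within X D C -> precedes X C D \/ C = D.
  by move=> h; have [|] := pselect (C = D); [right|left].
suff [M [vM hM up least]] : exists M, [/\ vertex M, within X Y M,
    forall s, S s -> within X M s & forall u, vertex u -> within X Y u ->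
      (forall s, S s -> within X u s) -> within X u M].
  exists M; split; first split.
  - by apply/closed_intervalP.
  - by move=> s /up/leP.
  - move=> u [/(closed_intervalP _ vX vY)[vu hu] ub]; apply: leP; apply: least => //.
    by move=> s /ub[[]|->].
have [[M SM up]|nomax] := pselect (exists2 M, S M & forall s, S s -> within X M s).
  by have [vM hM] := SXY _ SM; exists M; split=> // u _ _; apply.
have {}nomax s : S s -> exists2 t, S t & within X t s /\ t <> s.
  move=> Ss; apply: contrapT => nt; apply: nomax; exists s => // t St.
  have [vs hs] := SXY _ Ss; have [vt ht] := SXY _ St.
  have [-> //|ts] := pselect (t = s).
  case: (within_total vX vY vs vt hs ht) => // h; case: nt; exists t => //.
(* The eventual direction of the elements of S: without a maximum in S, a
   direction that leaves that of X moves on to that of Y. *)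
pose m A := if pselect (exists2 s, S s & dir A s = dir A Y) then dir A Y else dir A X.
have eventually A : calA A ->
    exists2 s, S s & forall t, S t -> within X t s -> dir A t = m A.
  move=> cA; rewrite /m; case: pselect => [[s Ss sY]|nY] /=.
    exists s => // t St st; have [_ ht] := SXY _ St.
    have := st _ cA; have := ht _ cA; rewrite sY.
    by move=> h1 h2; apply: star_asym (star_sym h1) (star_sym h2).
  exists s0 => // t St _; apply: contrapT => tX; apply: nY.
  have [u Su [tu ne]] := nomax _ St; exists u => //.
  have [vt ht] := SXY _ St; have [vu hu] := SXY _ Su.
  have := tu _ cA; have := hu _ cA => h1 h2.
  case: h1 => // [uX|[u0 XY]].
    by case: tX; apply: (@star_eq _ set0); rewrite -{2}uX.
  case: h2 => [//|e|[t0 _]].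
    by case: ne; apply/esym; rewrite (vertex_dir0 cA vu u0) (vertex_dir0 cA vt) // e.
  by case: ne; rewrite (vertex_dir0 cA vu u0) (vertex_dir0 cA vt t0).
have below A s : calA A -> S s -> star set0 (dir A X) (m A) (dir A s).
  move=> cA Ss; rewrite /m; case: pselect => [_|nY] /=; first exact: (SXY _ Ss).2.
  have [t St h] := eventually _ cA; move: h; rewrite /m; case: pselect => // _ /= h.
  have [u Su su] : exists2 u, S u & within X u s /\ within X u t.
    have [vs hs] := SXY _ Ss; have [vt ht] := SXY _ St.
    case: (within_total vX vY vs vt hs ht) => le; first by exists t.
    by exists s.
  by have := su.1 _ cA; rewrite (h _ Su su.2).
have common A B : calA A -> calA B ->
    exists2 s, S s & dir A s = m A /\ dir B s = m B.
  move=> cA cB; have [s Ss hs] := eventually _ cA; have [t St ht] := eventually _ cB.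
  have [vs hXs] := SXY _ Ss; have [vt hXt] := SXY _ St.
  case: (within_total vX vY vs vt hXs hXt) => le.
    by exists t => //; split; [exact: hs|exact: ht].
  by exists s => //; split; [exact: hs|exact: ht].
have mXY A : calA A -> m A = dir A X \/ m A = dir A Y.
  by move=> _; rewrite /m; case: pselect; [right|left].
have om : orientation m.
  split=> [A cA|A B cA cB AB]; last first.
    have [s Ss [<- <-]] := common _ _ cA cB.
    by apply: coherent => //; exact: (SXY _ Ss).1.
  have [s Ss hs] := eventually _ cA.
  have [t St [st ts]] := nomax _ Ss.
  have [vs _] := SXY _ Ss; have [vt _] := SXY _ St.
  have [e|sA] := pselect (s = A); last first.
    by rewrite -(hs s Ss (refl s)); apply: vertex_quasi.
  rewrite -(hs t St st); apply: vertex_quasi => // tA; apply: ts.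
  by rewrite tA e.
have least_m u A : (forall s, S s -> within X u s) -> calA A ->
    star set0 (dir A X) (dir A u) (m A).
  move=> ub cA; have [s Ss hs] := eventually _ cA.
  by rewrite -(hs s Ss (refl s)); exact: ub.
have [[M vM mM]|noM] := pselect (exists2 M, vertex M & forall A, calA A -> dir A M = m A).
  exists M; split=> //.
  - by move=> A cA; rewrite mM //; case: (mXY _ cA) => ->; [exact: star_l|exact: star_r].
  - by move=> s Ss A cA; rewrite mM //; exact: below.
  - by move=> u vu _ ub A cA; rewrite mM //; exact: least_m.
have differ M : vertex M -> exists2 A, calA A & dir A M <> m A.
  move=> vM; apply: contrapT => h; apply: noM; exists M => // A cA.
  by apply: contrapT => MA; apply: h; exists A.
case: (core_vertex om vX vY mXY (differ _ vX) (differ _ vY)) => [[bC mC]|].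
  by case: noM; exists (core m) => //; right.
set C := core m => -[cC XYC].
have dC A : calA A -> A <> C -> dir A C = m A.
  by move=> cA AC; apply: dir_core => //; apply: mem_not_subset => //; exact: nesym.
have vC : vertex C by left.
(* At C itself m is a tip and C the centre.  Since no vertex has all
   directions m, a vertex u between m and a W beyond C has left the tip m C. *)
have apart u W : vertex u -> vertex W -> 
    (forall A, calA A -> star set0 (m A) (dir A W) (dir A u)) ->
    dir C W <> m C -> dir C u <> m C.
  move=> vu vW hu WC uC; have [A cA uA] := differ _ vu.
  have AC : A <> C by move=> e; apply: uA; rewrite e.
  have WA : dir A W <> m A by move=> e; apply: uA; apply: (@star_eq _ set0); rewrite -{2}e; exact: hu.
  have WC' : dir C W = dir C A.
    by case: (coherent vW cA cC AC) => //; rewrite dC.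
  have : dir A u = dir A C.
    case: (coherent vu cA cC AC) => // e; case: WC; rewrite WC' -e//.
  by rewrite dC.
(* C is not on the side of X: the elements of S would already be beyond it. *)
have XC : dir C X = m C.
  apply: contrapT => XC; have [s Ss [sC _]] := common _ _ cC cC.
  apply: (apart s X (SXY _ Ss).1 vX _ XC sC) => A cA.
  by apply: star_sym; exact: below.
have YC : dir C Y <> m C by case: XYC.
exists C; split=> //.
- by apply: fork_within => //; rewrite XC; exact: nesym.
- move=> s Ss A cA; have [->|AC] := pselect (A = C); last first.
    by rewrite dC //; exact: below.
  have -> : dir C s = dir C X.
    by apply: (@star_eq _ set0); rewrite {2}XC; exact: below.
  exact: star_l.
- move=> u vu hu ub A cA; have [->|AC] := pselect (A = C); last first.
    by rewrite dC //; exact: least_m.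
  rewrite dir_id; apply: Or33; split=> //; rewrite XC; apply: nesym.
  apply: (apart u Y) => // B cB.
  exact: star_mid (least_m _ _ ub cB) (hu _ cB).
Qed.

(** * Separation and betweenness *)

(** For a block C, the sets [ahead] and [elsewhere] of the orientation given by C
form a separation of its complement. *)
Lemma betw_separates X Y C : vertex X -> vertex Y -> vertex C ->
  ~ X `<=` C -> ~ Y `<=` C -> betw X Y C -> separates_from C X Y.
Proof.
move=> vX vY vC /not_subset[x Xx Cx] /not_subset[y Yy Cy] [_ CX CY h].
apply/separates_fromP; first exact: vertex_closed.
exists x, y; split=> // xy.
have [iX iY] := (vertex_inseparable vX, vertex_inseparable vY).
case: vC => [cC|bC].
  have := h _ cC; rewrite dir_id; case=> [/esym||[_]].
  - exact: dir_neq0 Xx Cx.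
  - by move/esym; exact: dir_neq0 Yy Cy.
  - by apply; rewrite (dirE cC iX Xx Cx) (dirE cC iY Yy Cy); apply/dir_pointP.
have oC := block_orientation bC.
have CXY A : calA A -> dir A C = dir A X \/ dir A C = dir A Y.
  by move=> cA; case: (h _ cA) => [||[e _]]; [left|right|case: (orientation_neq0 oC cA)].
have [A cA Ax] := off_block bC Cx; have [B cB By] := off_block bC Cy.
have ahx : ahead X (dir^~ C) x by exists A => //; split=> //; exact: (dir_neq_of_off cA iX oC Xx Ax).
have ahy : ahead Y (dir^~ C) y by exists B => //; split=> //; exact: (dir_neq_of_off cB iY oC Yy By).
have CE := core_of_block bC.
have sC : side C (ahead X (dir^~ C)).
  have off z : ahead X (dir^~ C) z -> ~ C z.
    by rewrite -{2}CE => -[D cD [_ Dz]]; apply/coreP; exists D.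
  split; [exact: open_ahead| |exact: off].
  suff -> : ~` (C `|` ahead X (dir^~ C)) = elsewhere X (dir^~ C).
    exact: open_elsewhere.
  apply/seteqP; split=> z /=.
    move=> /not_orP[Cz nz]; have := @ahead_or_elsewhere _ oC X z vX.
    by rewrite CE => /(_ Cz)[].
  move=> ez [Cz|az]; last exact: (ahead_elsewhere oC az ez).
  case: ez => D cD [_ Dz]; have : ~ core (dir^~ C) z by apply/coreP; exists D.
  by rewrite CE.
apply: (ahead_elsewhere oC (xy _ sC ahx)).
exact: (ahead_sub_elsewhere oC vX vY CXY).
Qed.

(** A separation of the complement of C splits neither X nor Y
([block_not_separates]), nor the union of their parts off F, which lies in one
quasicomponent of the complement of F and is cut off from C by F. *)
Lemma dir_eq_not_separates X Y C F : vertex X -> vertex Y -> block C -> calA F ->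
  dir F X = dir F Y -> dir F X <> dir F C -> X <> F -> ~ separates_from C X Y.
Proof.
move=> vX vY bC cF XY XC XF.
move=> /(separates_fromP _ _ (vertex_closed (or_intror bC)))[x [y [[Xx Cx] [Yy Cy]]]]; apply.
have qX := vertex_quasi cF vX XF.
have YF : Y <> F.
  by move=> e; apply: (quasi_neq0 qX); rewrite XY e dir_id.
have [x' Xx' Fx'] : exists2 x', X x' & ~ F x'.
  by apply: not_subset => /(vertex_sub cF vX).
have [y' Yy' Fy'] : exists2 y', Y y' & ~ F y'.
  by apply: not_subset => /(vertex_sub cF vY).
have iX := vertex_inseparable vX; have iY := vertex_inseparable vY.
have x'y' : same F x' y'.
  by apply/dir_pointP => //; rewrite -(dirE cF iX) // -(dirE cF iY).
have qC := block_dir_quasi cF bC.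
have off z V : vertex V -> V z -> ~ F z -> dir F V <> dir F C -> (~` (dir F C `|` F)) z.
  move=> vV Vz Fz VC [Cz|//]; apply: VC.
  by rewrite (dirE cF (vertex_inseparable vV) Vz Fz) (quasiE qC Cz).
have offC z V : vertex V -> V z -> ~ F z -> dir F V <> dir F C -> ~ C z.
  by move=> vV Vz Fz VC Cz; have := off z V vV Vz Fz VC; apply; apply: sub_block_dir.
have Cx' : ~ C x' by exact: offC vX _ _ _.
have Cy' : ~ C y' by apply: (offC _ _ vY) => //; rewrite -XY.
apply: same_trans (block_not_separates bC vX Xx Xx' Cx Cx') _.
apply: same_trans _ (block_not_separates bC vY Yy' Yy Cy' Cy).
move=> S sS Sx'.
apply: (side_constant_off qC (sub_block_dir cF bC) sS x'y' _ Sx').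
exact: off vX _ _ _.
Qed.

(** If a block C separates X from Y without lying between them, some E in calA has
neither X nor Y in the direction of C.  Then E is contained in C, as
otherwise some F cuts E off from C and with it both X and Y; and E lies between
X and Y, as otherwise they would share a direction at E. *)
Lemma separates_betw X Y C : vertex X -> vertex Y -> vertex C ->
  ~ X `<=` C -> ~ Y `<=` C -> separates_from C X Y ->
  exists D, [/\ vertex D, betw X Y D & D `<=` C].
Proof.
move=> vX vY vC XC YC sep.
have CX : C <> X by move=> e; apply: XC; rewrite e.
have CY : C <> Y by move=> e; apply: YC; rewrite e.
have [x [y [[Xx Cx] [Yy Cy] xy]]] := (separates_fromP _ _ (vertex_closed vC)).1 sep.
case: (vC) => [cC|bC].
  exists C; split=> //; split=> //; apply: fork_within => //.
  rewrite (dirE cC (vertex_inseparable vX) Xx Cx).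
  by rewrite (dirE cC (vertex_inseparable vY) Yy Cy) => h; apply: xy; apply/dir_pointP.
have [h|] := pselect (within X Y C); first by exists C; split.
move=> /existsNP[E /not_implyP[cE nE]]; have [EX EY] := star_not nE.
have XY : X <> Y.
  by move=> e; apply: xy; apply: (block_not_separates bC vX) => //; rewrite e.
have [e|ne] := pselect (dir E X = dir E Y).
  exfalso; have [XE|XE] := pselect (X = E); last first.
    by apply: (dir_eq_not_separates vX vY bC cE e _ XE sep); exact: nesym.
  have e0 : dir E Y = set0 by rewrite -e XE dir_id.
  by apply: XY; rewrite XE (vertex_dir0 cE vY e0).
have [EC|] := pselect (E `<=` C).
  exists E; split=> //; first by left.
  split; [by left|by move=> h; apply: XC; rewrite -h|by move=> h; apply: YC; rewrite -h|].
  exact: fork_within.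
move=> /not_subset[z Ez Cz]; exfalso.
have [F cF Fz] := off_block bC Cz.
have oC := block_orientation bC.
have FE := dir_neq_of_off cF (inseparable_mem cE) oC Ez Fz.
have EF : E <> F by move=> h; case: Fz; right; rewrite -h.
have eC : dir E C = dir E F.
  by case: (oC.2 _ _ cE cF EF) => // h; case: FE; rewrite h.
have XF : dir F X = dir F E.
  by case: (coherent vX cE cF EF) => // h; case: EX; rewrite eC h.
have YF : dir F Y = dir F E.
  by case: (coherent vY cE cF EF) => // h; case: EY; rewrite eC h.
apply: (dir_eq_not_separates vX vY bC cF _ _ _ sep); rewrite ?XF ?YF //.
move=> h; have : quasi F (dir F E) by apply: vertex_quasi => //; left.
by rewrite -XF h dir_id => /quasi_neq0.
Qed.

(** * Preseparability *)

(** The members of calA in L form the dense set: two distinct blocks differ in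
their direction at some A, which then lies between them, and L is convex. *)
Lemma tree_preseparable :
  (forall L, linearly_ordered tree L -> countable (calA `&` L)) ->
  preseparable tree.
Proof.
move=> cL L lL; have [LP [lt [lin int]]] := lL.
exists (calA `&` L); split; [by move=> ? []|exact: cL|].
move=> X Y LX LY XY.
have vX := LP _ LX; have vY := LP _ LY.
have [cX|nX] := pselect (calA X).
  by exists X; split=> //; right; left.
have [cY|nY] := pselect (calA Y).
  by exists Y; split=> //; right; right.
have [A cA h] : exists2 A, calA A & dir A X <> dir A Y.
  apply: contrapT => h; apply: XY; apply: vertex_inj => // A cA.
  by apply: contrapT => XYA; apply: h; exists A.
have bA : between tree X Y A.
  split; [by left|by move=> e; rewrite e in cA|by move=> e; rewrite e in cA|].
  exact: fork_within.
exists A; split; first by left.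
split=> //; case: lin => _ _ /(_ X Y LX LY XY)[] l.
  by move: bA; rewrite -(int _ _ LX LY l) => -[].
by move: bA; rewrite between_sym // -(int _ _ LY LX l) => -[].
Qed.

Lemma tree_inseparable X C : vertex X -> vertex C -> ~ separates C X.
Proof.
move=> vX vC; apply/not_separatesP; first exact: vertex_closed.
move=> x y [Xx Cx] [Xy Cy]; case: vC => [cC|bC].
  exact: (vertex_inseparable vX).
exact: block_not_separates bC vX Xx Xy Cx Cy.
Qed.

End Tree.

(** * The pretree of a family of closed sets *)

Theorem theorem1 (Z : topologicalType) (calA : set (set Z))
  (Zconn : connected [set: Z])
  (Aclosed : forall A : set Z, calA A -> closed A)
  (A1 : forall A : set Z, calA A -> separates A [set: Z])
  (A2 : forall A B : set Z, calA A -> calA B -> ~ separates A B)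
  (A3 : forall A B : set Z, calA A -> calA B -> A <> B ->
     ~ separates (A `&` B) [set: Z]) :
  exists P : pretree (set Z),
    (complete_pretree P /\ median_pretree P) /\
    (forall A : set Z, carrier P A -> closed A) /\
    calA `<=` carrier P /\
    [set: Z] = \bigcup_(A in carrier P) A /\
    (forall A C : set Z, carrier P A -> carrier P C -> ~ separates C A) /\
    (forall A B C : set Z, carrier P A -> carrier P B -> carrier P C ->
       ~ (A `<=` C) -> ~ (B `<=` C) ->
       (between P A B C -> separates_from C A B) /\
       (separates_from C A B ->
          exists D : set Z, [/\ carrier P D, between P A B D & D `<=` C])) /\
    ((forall L : set (set Z), linearly_ordered P L -> countable (calA `&` L)) ->
       preseparable P).
Proof.
exists (tree Aclosed A1 A2 A3); split; first split.
- exact: tree_complete.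
- exact: tree_median.
split; first by move=> A; exact: vertex_closed.
split; first by move=> A; left.
split.
  apply/seteqP; split=> // z _.
  by have [X vX Xz] := vertex_cover Aclosed A1 A2 A3 z; exists X.
split; first by move=> A C; exact: tree_inseparable.
split; last exact: tree_preseparable.
by move=> A B C vA vB vC AC BC; split; [exact: betw_separates|exact: separates_betw].
Qed.
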